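(* Let $n\ge 1$, let $A,B$ be real symmetric $n\times n$ matrices, $a,b\in\mathbb{R}^n$, $f(x)=\langle Ax,x\rangle+\langle a,x\rangle$, $g(x)=\langle Bx,x\rangle+\langle b,x\rangle$, $F(x)=(f(x),g(x))$, $F_H(x)=(\langle Ax,x\rangle,\langle Bx,x\rangle)$ and $F_L(x)=(\langle a,x\rangle,\langle b,x\rangle)$ for $x\in\mathbb{R}^n$. Then $F(\mathbb{R}^n)$ is convex if and only if for every $d=(d_1,d_2)\in\mathbb{R}^2$, $d\ne0$, at least one of the following conditions holds: (C1) $F_L(\ker A\cap\ker B)\neq\{0\}$; (C2) $d_1B\ne d_2A$; (C3) $F_H^{-1}(-d)=\emptyset$; (C4) $\{d,F_L(u)\}$ is linearly dependent for some $u\in F_H^{-1}(-d)$.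
   Context: $F_H^{-1}(-d)=\{u\in\mathbb{R}^n: F_H(u)=-d\}$. *)

(* Defs.v *)
From HB Require Import structures.
From mathcomp Require Export all_boot all_order all_algebra.
From mathcomp Require Export boolp classical_sets reals convex.
Set Implicit Arguments.
Unset Strict Implicit.
Unset Printing Implicit Defensive.
Import Order.TTheory GRing.Theory Num.Theory.
Local Open Scope classical_set_scope.
Local Open Scope ring_scope.

(* Vectors of R^n are columns.  The plane R^2 is R^o * R^o: the regular modules
   R^o make the product a vector space over R, as [free] and [convex_set]
   require. *)

Definition inner (R : realType) (n : nat) (x y : 'cV[R]_n) : R :=
  (x^T *m y) 0 0.

Definition qfun (R : realType) (n : nat) (A : 'M[R]_n) (a : 'cV[R]_n)
    (x : 'cV[R]_n) : R :=
  inner (A *m x) x + inner a x.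

Definition joint (R : realType) (n : nat) (A B : 'M[R]_n) (a b : 'cV[R]_n)
    (x : 'cV[R]_n) : R^o * R^o :=
  (qfun A a x, qfun B b x).

Definition joint_H (R : realType) (n : nat) (A B : 'M[R]_n)
    (x : 'cV[R]_n) : R^o * R^o :=
  (inner (A *m x) x, inner (B *m x) x).

Definition joint_L (R : realType) (n : nat) (a b : 'cV[R]_n)
    (x : 'cV[R]_n) : R^o * R^o :=
  (inner a x, inner b x).

(* The library's [kermx] acts on row vectors and is a matrix, not a set. *)
Definition kernel (R : realType) (n : nat) (A : 'M[R]_n) : set 'cV[R]_n :=
  [set x | A *m x = 0].

(* [free] judges the pair (v, w) as a family, so v = w counts as dependent. *)
Definition lindep2 (R : realType) (v w : R^o * R^o) : Prop :=
  ~~ free [:: v; w].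

(* Main.v *)
(* Sufficiency.  Suppose a point strictly between F(x) and F(y) is missed.  After a
   rotation of the plane this says that g(x) = g(y) = q, f(x) < p < f(y), and that
   f = p has no solution on the quadric {g = q}.  Let m be the midpoint of x and y
   and w = (y - x)/2.  Then <Bw, w> <> 0 (otherwise the line through x and y lies in
   the quadric), and on the B-orthogonal complement W of w the quadric reads
   s^2 = psi(v) at m + s w + v.  If psi vanished somewhere, the sheets
   s = +-sqrt(psi) would be joined by a path from x to y; so psi > 0 on W, and f - p
   has constant opposite signs on the two sheets.  Comparing growth rates in v along
   lines, this forces f - lambda g to be affine for lambda = <Aw, w>/<Bw, w>, and its
   linear part is bounded by sqrt(psi).  Then d = -F_H(w) violates (C1)-(C4).
   Necessity is the midpoint argument of [convex_joint_lindep]. *)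
Require Import Defs.
From mathcomp Require Import all_boot all_order all_algebra.
From mathcomp Require Import boolp classical_sets reals convex.
From mathcomp Require unstable.
From mathcomp Require Import topology normedtype derive realfun.
From mathcomp Require Import interval_inference ring lra.
Set Implicit Arguments.
Unset Strict Implicit.
Unset Printing Implicit Defensive.
Import Order.TTheory GRing.Theory Num.Theory.
Import numFieldNormedType.Exports.
Local Open Scope classical_set_scope.
Local Open Scope ring_scope.

(** * Sign and growth arguments for real functions, and plane rotations *)

Lemma same_sign_of_neq0 (R : realType) (h : R -> R) :
  continuous h -> (forall t, 0 <= t <= 1 -> h t != 0) -> 0 < h 0 * h 1.
Proof.
move=> hc hn0; rewrite ltNge; apply/negP => h01.
have [] := @IVT R h 0 1 0 ler01 (continuous_subspaceT hc).
  by rewrite ge_min le_max; apply/andP; split; apply/orP; nra.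
by move=> t; rewrite in_itv /= => /hn0 /eqP.
Qed.

(** The shape taken by [f - p] along a path on one sheet of the quadric. *)
Lemma continuous_horner_sqrt (R : realType) (c : R) (P Q U : {poly R}) :
  continuous (fun t => P.[t] + Num.sqrt U.[t] * Q.[t] + c * Num.sqrt U.[t] ^+ 2).
Proof.
move=> t; have hc (p : {poly R}) : p.[x] @[x --> t] --> p.[t].
  exact: continuous_horner.
have sc : Num.sqrt U.[x] @[x --> t] --> Num.sqrt U.[t].
  by apply: continuous_comp; [exact: hc | exact: sqrt_continuous].
apply: cvgD; first by apply: cvgD; [exact: hc | apply: cvgM].
by apply: cvgM; [exact: cvg_cst | apply: cvgM].
Qed.

Lemma quadratic_lead_ge0 (R : realFieldType) (a b c : R) :
  (forall t, 0 <= t -> 0 < a * t ^+ 2 + b * t + c) -> 0 <= a.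
Proof.
move=> h; rewrite leNgt; apply/negP => a0.
(* This [t] is at least 1 and [a * t + b <= a - |c|], so the quadratic is at most [a * t < 0]. *)
pose t := 1 - (`|b| + `|c|) / a.
have at_ : a * t = a - (`|b| + `|c|) by rewrite /t; field; rewrite lt_eqF.
have hb := ler_norm b; have hc := ler_norm c.
have nb := normr_ge0 b; have nc := normr_ge0 c.
have t1 : 1 <= t.
  by rewrite /t lerDl oppr_ge0 mulr_ge0_le0 ?addr_ge0 // invr_le0 ltW.
have := h t (le_trans ler01 t1); rewrite expr2 mulrA at_; nra.
Qed.

Lemma affine_slope_eq0 (R : realFieldType) (k c : R) :
  (forall t, 0 < c + t * k) -> k = 0.
Proof.
move=> h; apply/eqP/negP => /negP k0; have := h (- c / k).
by rewrite divfK // subrr ltxx.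
Qed.

Lemma rotation_inj (R : realFieldType) (e1 e2 x y x' y' : R) :
  0 < e1 ^+ 2 + e2 ^+ 2 ->
  e1 * x + e2 * y = e1 * x' + e2 * y' -> e1 * y + - e2 * x = e1 * y' + - e2 * x' ->
  x = x' /\ y = y'.
Proof.
move=> e0 p q; have [p1 p2] := (congr1 ( *%R e1) p, congr1 ( *%R e2) p).
have [q1 q2] := (congr1 ( *%R e1) q, congr1 ( *%R e2) q).
by split; apply: (mulfI (lt0r_neq0 e0)); lra.
Qed.

(** * Bilinear algebra of the inner product *)

Section Inner.
Variables (R : realType) (n : nat).
Implicit Types (A : 'M[R]_n) (a x y z : 'cV[R]_n) (c : R).

Lemma innerDl x y z : inner (x + y) z = inner x z + inner y z.
Proof. by rewrite /inner linearD /= mulmxDl mxE. Qed.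

Lemma innerDr x y z : inner x (y + z) = inner x y + inner x z.
Proof. by rewrite /inner mulmxDr mxE. Qed.

Lemma innerZl c x y : inner (c *: x) y = c * inner x y.
Proof. by rewrite /inner linearZ /= -scalemxAl mxE. Qed.

Lemma innerZr c x y : inner x (c *: y) = c * inner x y.
Proof. by rewrite /inner -scalemxAr mxE. Qed.

Lemma innerNr x y : inner x (- y) = - inner x y.
Proof. by rewrite -scaleN1r innerZr mulN1r. Qed.

Lemma inner0l x : inner 0 x = 0.
Proof. by rewrite -(scale0r 0) innerZl mul0r. Qed.

Lemma inner0r x : inner x 0 = 0.
Proof. by rewrite -(scale0r 0) innerZr mul0r. Qed.

Lemma innerC x y : inner x y = inner y x.
Proof. by rewrite /inner -[y in LHS]trmxK -trmx_mul mxE. Qed.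

Lemma inner_mulmx_sym A x y : A^T = A -> inner (A *m x) y = inner (A *m y) x.
Proof. by move=> hA; rewrite innerC /inner trmx_mul hA mulmxA. Qed.

Lemma inner_mulmxD A x y z :
  inner (A *m (x + y)) z = inner (A *m x) z + inner (A *m y) z.
Proof. by rewrite mulmxDr innerDl. Qed.

Lemma inner_mulmxZ A c x y : inner (A *m (c *: x)) y = c * inner (A *m x) y.
Proof. by rewrite -scalemxAr innerZl. Qed.

Definition innerE :=
  (innerDl, innerDr, innerZl, innerZr, inner_mulmxD, inner_mulmxZ).

Lemma qfunD A a m x : A^T = A ->
  qfun A a (m + x) = inner (A *m x) x + (2 * inner (A *m m) x + inner a x) + qfun A a m.
Proof.
by move=> hA; rewrite /qfun !innerE (inner_mulmx_sym x m hA); ring.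
Qed.

Lemma sym_eq0P A : A^T = A -> (forall x, inner (A *m x) x = 0) -> A = 0.
Proof.
move=> hA h.
have pol x y : inner (A *m x) y = 0.
  have := h (x + y); rewrite !innerE !h (inner_mulmx_sym y x hA); lra.
apply/matrixP => i j; rewrite mxE -(pol (delta_mx j 0) (delta_mx i 0)).
by rewrite innerC /inner trmx_delta -rowE -colE !mxE.
Qed.

End Inner.

(** * A level set of [g] on which [f] misses a value, with [<Bw, w>] normalised to 1 *)

Section Separation.
Variables (R : realType) (n : nat) (A B : 'M[R]_n) (a b m w : 'cV[R]_n).
Variables (p q : R).
Hypotheses (hA : A^T = A) (hB : B^T = B) (Bw1 : inner (B *m w) w = 1).
Hypotheses (gp : qfun B b (m + w) = q) (gm : qfun B b (m - w) = q).
Hypotheses (fm : qfun A a (m - w) < p) (fp : p < qfun A a (m + w)).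
Hypothesis (no_sol : forall z, qfun B b z = q -> qfun A a z <> p).

Let W v := inner (B *m w) v = 0.
Let l v := 2 * inner (B *m m) v + inner b v.
Let k v := 2 * inner (A *m m) v + inner a v.
(* The level set [qfun B b = q] is [s ^+ 2 = psi v] at [m + s *: w + v]. *)
Let psi v := 1 - inner (B *m v) v - l v.

Let qfun_section (C : 'M[R]_n) c s t v : C^T = C ->
  qfun C c (m + (s *: w + t *: v)) =
    s ^+ 2 * inner (C *m w) w + 2 * s * t * inner (C *m w) v
    + t ^+ 2 * inner (C *m v) v + s * (2 * inner (C *m m) w + inner c w)
    + t * (2 * inner (C *m m) v + inner c v) + qfun C c m.
Proof. by move=> hC; rewrite qfunD // !innerE (inner_mulmx_sym v w hC); ring. Qed.

(** [m] is the midpoint of two points of the same level set, so the odd part along [w] cancels. *)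
Let lw0 : l w = 0.
Proof. by have := gp; have := gm; rewrite -scaleN1r !qfunD // /l !innerE; lra. Qed.

Let level_section s t v : W v ->
  qfun B b (m + (s *: w + t *: v)) = q + (s ^+ 2 - psi (t *: v)).
Proof.
have gm0 : qfun B b m = q - 1 by have := gp; rewrite qfunD // -/(l w) lw0 Bw1; lra.
by move=> Wv; rewrite qfun_section // -/(l w) lw0 gm0 Bw1 Wv /psi /l !innerE; ring.
Qed.

Let W_scale t v : W v -> W (t *: v).
Proof. by rewrite /W innerZr => ->; rewrite mulr0. Qed.

(** The path [m + e sqrt(psi (t v)) w + t v] stays in the level set and starts at [m + e w] because
    [psi 0 = 1]; [f - p] has no zero on it. The sign [e] selects the sheet. *)
Let same_sign_on_sheet (e : R) v : e ^+ 2 = 1 -> W v ->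
  (forall t, 0 <= t <= 1 -> 0 <= psi (t *: v)) ->
  0 < (qfun A a (m + e *: w) - p)
      * (qfun A a (m + ((e * Num.sqrt (psi v)) *: w + v)) - p).
Proof.
move=> e1 Wv psi0.
pose h t := qfun A a (m + ((e * Num.sqrt (psi (t *: v))) *: w + t *: v)) - p.
have hc : continuous h.
  pose U := 1 - (inner (B *m v) v)%:P * 'X^2 - (l v)%:P * 'X.
  pose P := (inner (A *m v) v)%:P * 'X^2 + (k v)%:P * 'X + (qfun A a m - p)%:P.
  pose Q := (e * 2 * inner (A *m w) v)%:P * 'X
    + (e * (2 * inner (A *m m) w + inner a w))%:P.
  suff -> : h = fun t => P.[t] + Num.sqrt U.[t] * Q.[t]
      + inner (A *m w) w * Num.sqrt U.[t] ^+ 2 by exact: continuous_horner_sqrt.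
  apply/funext => t; have -> : U.[t] = psi (t *: v).
    by rewrite /U /psi !hornerE /= /l !innerE; ring.
  by rewrite /h qfun_section // exprMn e1 !hornerE /= /k; ring.
have := same_sign_of_neq0 hc; rewrite /h scale0r scale1r addr0.
have -> : psi 0 = 1 by rewrite /psi /l mulmx0 !inner0r mulr0 addr0 !subr0.
rewrite sqrtr1 mulr1; apply => t t01; rewrite subr_eq0; apply/eqP/no_sol.
by rewrite level_section // exprMn e1 mul1r sqr_sqrtr ?psi0 // subrr addr0.
Qed.

(** Otherwise [psi] has a first zero on the ray through [v]. The two sheets meet there, and [f - p]
    would inherit opposite signs from [m + w] and [m - w]. *)
Let psi_gt0 v : W v -> 0 < psi v.
Proof.
move=> Wv; rewrite ltNge; apply/negP.
set Q := inner (B *m v) v; set L := l v => psi_le0.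
have QL : 1 <= Q + L by move: psi_le0; rewrite /psi -/Q -/L; lra.
have := sqr_ge0 (L - 2); rewrite expr2 => L2.
have D0 : 0 <= L ^+ 2 + 4 * Q by nra.
have := sqrtr_ge0 (L ^+ 2 + 4 * Q); have := sqr_sqrtr D0.
set r := Num.sqrt _ => r2 r0.
(* [tau^-1] is the smallest positive root of [t |-> psi (t *: v)]. *)
pose tau := (L + r) / 2.
have tau1 : 1 <= tau by rewrite /tau; nra.
have tau_eq : tau ^+ 2 = L * tau + Q by rewrite /tau; lra.
pose x := tau^-1; have xtau : x * tau = 1 by rewrite mulVf // gt_eqF //; lra.
have QL1 : x ^+ 2 * Q + x * L = 1.
  have -> : Q = tau ^+ 2 - L * tau by lra.
  have -> : x ^+ 2 * (tau ^+ 2 - L * tau) + x * L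
      = (x * tau) ^+ 2 + x * L * (1 - x * tau) by ring.
  by rewrite xtau; ring.
(* This keeps the second factor of [psi_x] nonnegative on [0, 1]. *)
have Q1 : -1 <= x ^+ 2 * Q.
  have : 0 <= x ^+ 2 * (tau ^+ 2 + Q).
    by rewrite mulr_ge0 ?sqr_ge0 //; rewrite tau_eq /tau; nra.
  by rewrite mulrDr -exprMn xtau; lra.
have psi_x t : psi (t *: (x *: v)) = (1 - t) * (1 + t * (x ^+ 2 * Q)).
  have -> : psi (t *: (x *: v)) = 1 - t ^+ 2 * (x ^+ 2 * Q) - t * (x * L).
    by rewrite /psi /L /l /Q !innerE; ring.
  have -> : x * L = 1 - x ^+ 2 * Q by lra.
  ring.
have nneg t : 0 <= t <= 1 -> 0 <= psi (t *: (x *: v)).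
  by rewrite psi_x => /andP[t0 t1]; rewrite mulr_ge0 ?subr_ge0 //; nra.
have psi0 : psi (x *: v) = 0 by rewrite -[x *: v]scale1r psi_x; ring.
have Wx := W_scale x Wv.
have := same_sign_on_sheet (expr1n _ 2) Wx nneg.
have := same_sign_on_sheet (etrans (sqrrN 1) (expr1n _ 2)) Wx nneg.
rewrite psi0 sqrtr0 !mulr0 scale0r add0r scaleN1r scale1r; have := fm; have := fp.
nra.
Qed.

(** Eliminating [s ^+ 2 = psi v] turns [f - p] at [m + s w + v] into
    [E v + K v + Z + s (al + 2 <Aw, v>)] for [v] in [W]. *)
Let al := 2 * inner (A *m m) w + inner a w.
Let lam := inner (A *m w) w.
Let E v := inner (A *m v) v - lam * inner (B *m v) v.
Let K v := k v - lam * l v.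
Let Z := qfun A a m - p + lam.

(* [qfun A a - p] is positive on the sheet [s = sqrt (psi v)] and negative on
   the opposite one. *)
Let sheet_bound v : W v ->
  0 < al + 2 * inner (A *m w) v /\
  (E v + K v + Z) ^+ 2 < psi v * (al + 2 * inner (A *m w) v) ^+ 2.
Proof.
move=> Wv; have psiv := psi_gt0 Wv.
have nneg t : 0 <= t <= 1 -> 0 <= psi (t *: v).
  by move=> _; apply/ltW/psi_gt0/W_scale.
have := same_sign_on_sheet (expr1n _ 2) Wv nneg.
have := same_sign_on_sheet (etrans (sqrrN 1) (expr1n _ 2)) Wv nneg.
have := sqr_sqrtr (ltW psiv); have : 0 < Num.sqrt (psi v) by rewrite sqrtr_gt0.
set r := Num.sqrt _ => r0 r2; rewrite scaleN1r scale1r mulN1r mul1r.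
rewrite nmulr_rgt0 ?pmulr_rgt0 ?subr_gt0 ?subr_lt0 //.
set c := inner (A *m w) v.
have secE s : qfun A a (m + (s *: w + v))
    = s ^+ 2 * lam + s * (al + 2 * c) + inner (A *m v) v + k v + qfun A a m.
  by rewrite -{1}(scale1r v) qfun_section // /al /lam /k /c; ring.
rewrite !secE => neg pos.
have EKZ : r ^+ 2 * lam + inner (A *m v) v + k v + (qfun A a m - p) = E v + K v + Z.
  by rewrite r2 /psi /E /K /Z; ring.
have : - (r * (al + 2 * c)) < E v + K v + Z < r * (al + 2 * c).
  by rewrite -EKZ; apply/andP; split; lra.
move=> /andP[lo hi]; split.
  by rewrite -(pmulr_rgt0 _ r0); lra.
by rewrite -r2 -exprMn !expr2; nra.
Qed.

(** An affine function of [t] that stays positive on the whole line is constant. *)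
Let A_orth v : W v -> inner (A *m w) v = 0.
Proof.
move=> Wv; have /affine_slope_eq0 : forall t, 0 < al + t * (2 * inner (A *m w) v).
  move=> t; have [] := sheet_bound (W_scale t Wv).
  by rewrite innerZr mulrCA.
lra.
Qed.

Let K_scale t v : K (t *: v) = t * K v.
Proof. by rewrite /K /k /l !innerE; ring. Qed.

Let sheet_bound_line v t : W v ->
  (t ^+ 2 * E v + t * K v + Z) ^+ 2
  < (1 - t ^+ 2 * inner (B *m v) v - t * l v) * al ^+ 2.
Proof.
move=> Wv; have [_] := sheet_bound (W_scale t Wv).
rewrite (A_orth (W_scale t Wv)) mulr0 addr0 K_scale.
have -> : psi (t *: v) = 1 - t ^+ 2 * inner (B *m v) v - t * l v.
  by rewrite /psi /l !innerE; ring.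
by have -> : E (t *: v) = t ^+ 2 * E v by rewrite /E !innerE; ring.
Qed.

(** The left side of [sheet_bound_line] has degree 4 in [t], the right side degree 2. Averaging over
    [t] and [- t] removes the odd terms and leaves a quadratic in [u = t ^+ 2] with leading
    coefficient [- E v ^+ 2]. *)
Let E_eq0 v : W v -> E v = 0.
Proof.
move=> Wv; apply/eqP; rewrite -sqrf_eq0 eq_le sqr_ge0 andbT -oppr_ge0.
apply: (@quadratic_lead_ge0 _ _ (- (2 * E v * Z + al ^+ 2 * inner (B *m v) v))
  (al ^+ 2 - Z ^+ 2)) => u u0.
have := sqr_sqrtr u0; set t := Num.sqrt u => <-.
have := sheet_bound_line t Wv; have := sheet_bound_line (- t) Wv.
have := sqr_ge0 (t * K v); rewrite !sqrrN; lra.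
Qed.

(** With [E v = 0] both sides of [sheet_bound_line] are quadratic in [t]; their leading coefficients
    are compared. *)
Let K_bound v : W v -> K v ^+ 2 <= - al ^+ 2 * inner (B *m v) v.
Proof.
move=> Wv; rewrite -subr_ge0.
apply: (@quadratic_lead_ge0 _ _ (- (2 * K v * Z + al ^+ 2 * l v))
  (al ^+ 2 - Z ^+ 2)) => t _.
have := sheet_bound_line t Wv; rewrite E_eq0 //; lra.
Qed.

Let al_gt0 : 0 < al.
Proof.
have W0 : W 0 by rewrite /W inner0r.
by have [] := sheet_bound W0; rewrite inner0r mulr0 addr0.
Qed.

Let decompose x : exists s v, W v /\ x = s *: w + v.
Proof.
exists (inner (B *m w) x), (x - inner (B *m w) x *: w); split; last first.
  by rewrite addrC subrK.
by rewrite /W innerDr innerNr innerZr Bw1 mulr1 subrr.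
Qed.

(** The form of [A - lam B] vanishes on [w] by the choice of [lam], on [W] by [E_eq0], and on cross
    terms by [A_orth]. *)
Lemma separated_dependent : A = lam *: B.
Proof.
apply/eqP; rewrite -subr_eq0; apply/eqP/sym_eq0P => [|x].
  by rewrite linearB linearZ /= hA hB.
have [s [v [Wv ->]]] := decompose x.
have Ev := E_eq0 Wv; rewrite /E in Ev.
have Av := A_orth Wv; have Bv : inner (B *m w) v = 0 := Wv.
rewrite mulmxBl -scaleN1r -scalemxAl !innerE.
rewrite (inner_mulmx_sym v w hA) (inner_mulmx_sym v w hB) Av Bv Bw1 -/lam.
lra.
Qed.

Let K_eq v : K v = inner a v - lam * inner b v.
Proof. by rewrite /K /k /l separated_dependent -scalemxAl innerZl; ring. Qed.

(** The kernel of [B] lies in [W]. On it [psi] is affine and positive, which kills [b]; then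
    [K_bound] kills [a]. *)
Lemma separated_kernel z : B *m z = 0 -> inner a z = 0 /\ inner b z = 0.
Proof.
move=> Bz; have Wz : W z by rewrite /W (inner_mulmx_sym _ _ hB) Bz inner0l.
have lz : l z = inner b z by rewrite /l (inner_mulmx_sym _ _ hB) Bz inner0l mulr0 add0r.
have bz : inner b z = 0.
  suff : - inner b z = 0 by lra.
  apply: (@affine_slope_eq0 _ _ 1) => t; have := psi_gt0 (W_scale t Wz).
  rewrite /psi /l !innerE Bz inner0l (inner_mulmx_sym _ _ hB) Bz inner0l; lra.
split=> //; have := K_bound Wz; rewrite Bz inner0l mulr0 K_eq bz mulr0 subr0.
by move=> a0; apply/eqP; rewrite -sqrf_eq0 eq_le a0 sqr_ge0.
Qed.

(** For [u = s w + v], equality would force [K v = - s al], and [K_bound] would give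
    [s ^+ 2 <= - <Bv, v> = s ^+ 2 - 1]. *)
Lemma separated_independent u :
  inner (B *m u) u = 1 -> inner a u <> lam * inner b u.
Proof.
have [s [v [Wv ->]]] := decompose u => Bu au.
have Bv : inner (B *m w) v = 0 := Wv.
have {Bu} Bu : s ^+ 2 + inner (B *m v) v = 1.
  by rewrite -Bu !innerE (inner_mulmx_sym v w hB) Bv Bw1; ring.
have alE : al = inner a w - lam * inner b w.
  rewrite -[LHS]subr0 -[in X in _ - X](mulr0 lam) -lw0 /al /l.
  by rewrite {1}separated_dependent -scalemxAl innerZl; ring.
have Kv : K v = - (s * al) by rewrite K_eq alE; move: au; rewrite !innerE; lra.
have := K_bound Wv; rewrite Kv sqrrN exprMn; have := al_gt0; nra.
Qed.

End Separation.

(** * From a gap in the joint image to an exceptional direction *)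

Section Joint.
Variables (R : realType) (n : nat).
Implicit Types (A B : 'M[R]_n) (a b x y z m w : 'cV[R]_n).

Lemma inner_mulmxDl A B x y :
  inner ((A + B) *m x) y = inner (A *m x) y + inner (B *m x) y.
Proof. by rewrite mulmxDl innerDl. Qed.

Lemma inner_mulmxZl (c : R) A x y : inner ((c *: A) *m x) y = c * inner (A *m x) y.
Proof. by rewrite -scalemxAl innerZl. Qed.

Lemma qfunZ (c : R) A a x : qfun (c *: A) (c *: a) x = c * qfun A a x.
Proof. by rewrite /qfun inner_mulmxZl innerZl mulrDr. Qed.

Lemma qfun_lin (c d : R) A B a b x :
  qfun (c *: A + d *: B) (c *: a + d *: b) x = c * qfun A a x + d * qfun B b x.
Proof. by rewrite /qfun inner_mulmxDl !inner_mulmxZl innerDl !innerZl; ring. Qed.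

Lemma separated_direction A B a b m w (p q : R) : A^T = A -> B^T = B ->
  qfun B b (m + w) = q -> qfun B b (m - w) = q ->
  qfun A a (m - w) < p -> p < qfun A a (m + w) ->
  (forall z, qfun B b z = q -> qfun A a z <> p) ->
  [/\ inner (B *m w) w != 0,
      inner (A *m w) w *: B = inner (B *m w) w *: A,
      forall z, B *m z = 0 -> inner a z = 0 /\ inner b z = 0
    & forall u, inner (B *m u) u = inner (B *m w) w ->
        inner (A *m w) w * inner b u <> inner (B *m w) w * inner a u].
Proof.
move=> hA hB gp gm fm fp no_sol; set N := inner (B *m w) w.
have N0 : N != 0.
  apply/eqP => N0.
  have lw0 : 2 * inner (B *m m) w + inner b w = 0.
    by have := gp; have := gm; rewrite -scaleN1r !qfunD // !innerE; lra.
  have gm0 : qfun B b m = q by have := gp; rewrite qfunD // -/N lw0 N0; lra.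
  (* If [<Bw, w> = 0], the whole line through [m - w] and [m + w] lies in the level set; [P] is
     [f - p] on it, with these two points at [t = 0] and [t = 1]. *)
  pose P := (inner (A *m w) w)%:P * (2%:P * 'X - 1) ^+ 2
    + (2 * inner (A *m m) w + inner a w)%:P * (2%:P * 'X - 1)
    + (qfun A a m - p)%:P.
  have PE t : P.[t] = qfun A a (m + (2 * t - 1) *: w) - p.
    by rewrite qfunD // /P !hornerE /= !innerE; ring.
  have /same_sign_of_neq0 : continuous (horner P) by exact: continuous_horner.
  have Pn0 t : 0 <= t <= 1 -> P.[t] != 0.
    move=> _; rewrite PE subr_eq0; apply/eqP/no_sol.
    set s := 2 * t - 1; have := congr1 ( *%R s) lw0.
    by rewrite qfunD // !innerE -/N N0 gm0; lra.
  move=> /(_ Pn0); rewrite !PE mulr0 sub0r scaleN1r.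
  have -> : 2 * 1 - 1 = 1 :> R by ring.
  by rewrite scale1r; have := fm; have := fp; nra.
(* Dividing [B], [b] and [q] by [N], of either sign, keeps the level set and normalises
   [<Bw, w>]. *)
have hB' : (N^-1 *: B)^T = N^-1 *: B by rewrite linearZ /= hB.
have Bw1 : inner ((N^-1 *: B) *m w) w = 1 by rewrite inner_mulmxZl mulVf.
have gp' : qfun (N^-1 *: B) (N^-1 *: b) (m + w) = N^-1 * q by rewrite qfunZ gp.
have gm' : qfun (N^-1 *: B) (N^-1 *: b) (m - w) = N^-1 * q by rewrite qfunZ gm.
have no_sol' z : qfun (N^-1 *: B) (N^-1 *: b) z = N^-1 * q -> qfun A a z <> p.
  by rewrite qfunZ => /(mulfI (invr_neq0 N0)) /no_sol.
split=> //.
- rewrite {2}(separated_dependent hA hB' Bw1 gp' gm' fm fp no_sol').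
  by rewrite !scalerA mulrAC mulfV // mul1r.
- move=> z Bz.
  have [|-> /eqP] := separated_kernel hA hB' Bw1 gp' gm' fm fp no_sol' (z := z).
    by rewrite -scalemxAl Bz scaler0.
  by rewrite innerZl mulf_eq0 invr_eq0 (negbTE N0) => /eqP.
- move=> u Bu eq_u.
  apply: (separated_independent hA hB' Bw1 gp' gm' fm fp no_sol' (u := u)).
    by rewrite inner_mulmxZl Bu mulVf.
  by apply: (mulfI N0); rewrite innerZl -eq_u; field.
Qed.

(** Rotating the plane so that [e = F(y) - F(x)] spans the first axis makes the second coordinate
    constant on the segment, as [separated_direction] requires. *)
Lemma gap_direction A B a b x y (p q k : R) : A^T = A -> B^T = B ->
  0 < k -> k < 1 ->
  p = k * qfun A a x + (1 - k) * qfun A a y ->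
  q = k * qfun B b x + (1 - k) * qfun B b y ->
  (forall z, qfun A a z = p -> qfun B b z <> q) ->
  exists w,
  [/\ ~ (inner (A *m w) w = 0 /\ inner (B *m w) w = 0),
      inner (A *m w) w *: B = inner (B *m w) w *: A,
      forall z, A *m z = 0 -> B *m z = 0 -> inner a z = 0 /\ inner b z = 0
    & forall u, inner (A *m u) u = inner (A *m w) w ->
        inner (B *m u) u = inner (B *m w) w ->
        inner (A *m w) w * inner b u <> inner (B *m w) w * inner a u].
Proof.
move=> hA hB k0 k1 pE qE no_sol.
pose e1 := qfun A a y - qfun A a x; pose e2 := qfun B b y - qfun B b x.
have e0 : 0 < e1 ^+ 2 + e2 ^+ 2.
  rewrite lt_def addr_ge0 ?sqr_ge0 // andbT paddr_eq0 ?sqr_ge0 // !sqrf_eq0.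
  apply/negP => /andP[/eqP d1 /eqP d2]; apply: (no_sol x).
    by rewrite pE; move: d1; rewrite /e1; nra.
  by rewrite qE; move: d2; rewrite /e2; nra.
pose m := 2^-1 *: (x + y); pose w := 2^-1 *: (y - x).
have mw : m + w = y.
  by apply/matrixP => i j; rewrite !mxE; field.
have mBw : m - w = x by apply/matrixP => i j; rewrite !mxE; field.
have hA' : (e1 *: A + e2 *: B)^T = e1 *: A + e2 *: B.
  by rewrite linearD !linearZ /= hA hB.
have hB' : (e1 *: B + (- e2) *: A)^T = e1 *: B + (- e2) *: A.
  by rewrite linearD !linearZ /= hA hB.
have [] := @separated_direction _ _ (e1 *: a + e2 *: b) (e1 *: b + (- e2) *: a)
  m w (e1 * p + e2 * q) (e1 * q + - e2 * p) hA' hB'.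
- by rewrite mw qfun_lin pE qE /e1 /e2; ring.
- by rewrite mBw qfun_lin pE qE /e1 /e2; ring.
- rewrite mBw qfun_lin pE qE -subr_gt0.
  rewrite (_ : _ - _ = (1 - k) * (e1 ^+ 2 + e2 ^+ 2)); last by rewrite /e1 /e2; ring.
  by rewrite mulr_gt0 // subr_gt0.
- rewrite mw qfun_lin pE qE -subr_gt0.
  rewrite (_ : _ - _ = k * (e1 ^+ 2 + e2 ^+ 2)); last by rewrite /e1 /e2; ring.
  by rewrite mulr_gt0.
- move=> z; rewrite !qfun_lin => g0 f0.
  by have [] := rotation_inj e0 f0 g0; exact: no_sol.
rewrite !inner_mulmxDl !inner_mulmxZl => N0 dep ker indep; exists w; split.
- by move=> [Aw Bw]; move: N0; rewrite Aw Bw !mulr0 addr0 eqxx.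
- apply: (scalerI (lt0r_neq0 e0)); apply/matrixP => i j.
  by have /matrixP/(_ i j) := dep; rewrite !mxE; lra.
- move=> z Az Bz; have [|] := ker z.
    by rewrite mulmxDl -!scalemxAl Az Bz !scaler0 addr0.
  rewrite !innerDl !innerZl => E1 E2; apply: (rotation_inj e0).
    by rewrite E1 !mulr0 addr0.
  by rewrite E2 !mulr0 addr0.
- move=> u Au Bu; have := indep u.
  rewrite !inner_mulmxDl !inner_mulmxZl Au Bu !innerDl !innerZl => /(_ erefl) ne eq_u.
  by apply: ne; nra.
Qed.

(** The columns of [cokermx A] lie in the kernel of [A], so [a^T] is in the row space, which by
    symmetry is the image. *)
Lemma sym_im_orth_ker A a : A^T = A ->
  (forall z, A *m z = 0 -> inner a z = 0) ->
  exists c, forall x, inner (A *m c) x = inner a x.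
Proof.
move=> hA a_ker.
have /submxP[D aD] : (a^T <= A)%MS.
  rewrite submxE; apply/eqP/matrixP => i j; rewrite ord1 [RHS]mxE.
  rewrite -(a_ker (col j (cokermx A))); last first.
    by rewrite colE mulmxA mulmx_coker mul0mx.
  by rewrite /inner !mxE; apply: eq_bigr => r _; rewrite !mxE.
exists D^T => x; rewrite /inner trmx_mul hA trmxK.
by rewrite -aD.
Qed.
End Joint.

(** * Linear dependence in the plane, and necessity of the conditions *)

Lemma lindep2P (R : realType) (v w : R^o * R^o) :
  lindep2 v w <-> v.1 * w.2 = v.2 * w.1.
Proof.
rewrite /lindep2 free_cons span_seq1 seq1_free negb_and !negbK.
case: v w => [v1 v2] [w1 w2] /=; split.
  case/orP => [/vlineP[k /= []] -> -> | /eqP[-> ->]]; last by rewrite !mulr0.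
  by rewrite /GRing.scale /=; ring.
have [-> | w1n0] := eqVneq w1 0.
  have [-> _ | w2n0] := eqVneq w2 0; first by rewrite eqxx orbT.
  rewrite mulr0 => /eqP; rewrite mulf_eq0 (negbTE w2n0) orbF => /eqP ->.
  apply/orP; left; apply/vlineP; exists (v2 / w2).
  by congr pair; rewrite /GRing.scale /= ?mulr0 ?divfK.
move=> vw; apply/orP; left; apply/vlineP; exists (v1 / w1).
congr pair; rewrite /GRing.scale /= ?divfK //.
by rewrite mulrAC vw mulfK.
Qed.

(* [A] and [B] are proportional to [S := d.1 *: A + d.2 *: B], and the component
   of [joint_L a b] along [d] lies in the image of [S], so a translation by some
   [- c] absorbs it.  Up to a constant, the image of [- c + x] is then its
   quadratic part plus a linear term orthogonal to [d].  Hence the midpoint of the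
   images of [- c + u] and [- c - u] is the image of some [- c + z] at which the
   linear term vanishes. *)
Lemma convex_joint_lindep (R : realType) (n : nat) (A B : 'M[R]_n)
    (a b u : 'cV[R]_n) (d : R^o * R^o) : A^T = A -> B^T = B -> d <> 0 ->
  convex_set (joint A B a b @` [set: 'cV[R]_n]) ->
  joint_L a b @` (kernel A `&` kernel B) = [set 0] ->
  d.1 *: B = d.2 *: A -> joint_H A B u = - d ->
  exists2 z, joint_H A B z = - d & lindep2 d (joint_L a b z).
Proof.
case: d => d1 d2 hA hB d0 cvx L0 dBA [Au Bu]; rewrite /= in dBA Au Bu *.
have ker z : A *m z = 0 -> B *m z = 0 -> inner a z = 0 /\ inner b z = 0.
  move=> Az Bz; have : (joint_L a b @` (kernel A `&` kernel B)) (joint_L a b z).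
    by exists z.
  by rewrite L0 => -[].
pose N := d1 ^+ 2 + d2 ^+ 2.
have N0 : N != 0.
  rewrite paddr_eq0 ?sqr_ge0 // !sqrf_eq0; apply/negP => /andP[/eqP e1 /eqP e2].
  by apply: d0; rewrite e1 e2.
pose S := d1 *: A + d2 *: B.
have AS : N *: A = d1 *: S.
  apply/matrixP => i j; have /matrixP/(_ i j) := dBA; rewrite !mxE.
  by move=> /(congr1 ( *%R d2)); rewrite /N; lra.
have BS : N *: B = d2 *: S.
  apply/matrixP => i j; have /matrixP/(_ i j) := dBA; rewrite !mxE.
  by move=> /(congr1 ( *%R d1)); rewrite /N; lra.
have hS : S^T = S by rewrite linearD !linearZ /= hA hB.
(* The factor [2^-1] matches the 2 in the cross term of [qfunD]. *)
have [|c cE] := @sym_im_orth_ker _ _ S (2^-1 *: (d1 *: a + d2 *: b)) hS.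
  move=> z Sz; have [||az bz] := ker z.
  - by apply: (scalerI N0); rewrite scalemxAl AS -scalemxAl Sz !scaler0.
  - by apply: (scalerI N0); rewrite scalemxAl BS -scalemxAl Sz !scaler0.
  by rewrite !innerE az bz !mulr0 addr0 mulr0.
(* Up to the factor [N], the coordinate of [joint_L a b x] along [(- d2, d1)]. *)
pose ell x := d1 * inner b x - d2 * inner a x.
have fE x : qfun A a (- c + x) = inner (A *m x) x - d2 * ell x / N + qfun A a (- c).
  rewrite qfunD //; congr (_ + _ + _); apply: (mulfI N0).
  have := congr1 (fun M => inner (M *m c) x) AS; rewrite /= !inner_mulmxZl cE.
  rewrite -scaleN1r !innerE => e; rewrite mulrDr.
  rewrite (_ : N * (2 * _) = - 2 * (N * inner (A *m c) x)); last by ring.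
  by rewrite e /ell; rewrite /N; field; rewrite -/N.
have gE x : qfun B b (- c + x) = inner (B *m x) x + d1 * ell x / N + qfun B b (- c).
  rewrite qfunD //; congr (_ + _ + _); apply: (mulfI N0).
  have := congr1 (fun M => inner (M *m c) x) BS; rewrite /= !inner_mulmxZl cE.
  rewrite -scaleN1r !innerE => e; rewrite mulrDr.
  rewrite (_ : N * (2 * _) = - 2 * (N * inner (B *m c) x)); last by ring.
  by rewrite e /ell; rewrite /N; field; rewrite -/N.
have half0 : 0 <= 2^-1 :> R by lra.
have half1 : 2^-1 <= 1 :> R by lra.
have im x : joint A B a b x \in joint A B a b @` [set: 'cV[R]_n].
  by rewrite inE; exists x.
have := cvx _ _ (Itv01 half0 half1) (im (- c + u)) (im (- c + - u)).
rewrite inE => -[y _ [fy gy]].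
have [z yE] : exists z, y = - c + z by exists (c + y); rewrite addKr.
move: fy gy; rewrite yE /GRing.scale /= !fE !gE /unstable.onem.
have ellN : ell (- u) = - ell u by rewrite /ell !innerNr; ring.
have qN M : inner (M *m - u) (- u) = inner (M *m u) u.
  by rewrite -scaleN1r !innerE; ring.
rewrite ellN !qN Au Bu => fz gz.
have ABz : d1 * inner (B *m z) z = d2 * inner (A *m z) z.
  by have := congr1 (fun M => inner (M *m z) z) dBA; rewrite /= !inner_mulmxZl.
have {}fz : inner (A *m z) z - d2 * ell z / N = - d1 by lra.
have {}gz : inner (B *m z) z + d1 * ell z / N = - d2 by lra.
(* Pairing [fz] and [gz] with [(- d2, d1)] isolates [ell z]; the quadratic parts cancel by [ABz]. *)
have ellz : ell z = 0.
  have -> : ell z = d1 * (d1 * ell z / N) + d2 * (d2 * ell z / N).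
    by rewrite /N; field; rewrite -/N.
  have -> : d1 * ell z / N = - d2 - inner (B *m z) z by lra.
  have -> : d2 * ell z / N = inner (A *m z) z + d1 by lra.
  by rewrite mulrBr ABz; ring.
exists z; last by apply/lindep2P => /=; move: ellz; rewrite /ell; lra.
by congr pair; rewrite /=; move: fz gz; rewrite ellz !mulr0 mul0r subr0 addr0.
Qed.

Theorem theorem4p15 (R : realType) (n : nat) (A B : 'M[R]_n) (a b : 'cV[R]_n)
    (hn : (1 <= n)%N) (hA : A^T = A) (hB : B^T = B) :
  convex_set (joint A B a b @` [set: 'cV[R]_n]) <->
  (forall d : R^o * R^o, d <> 0 ->
    [\/ joint_L a b @` (kernel A `&` kernel B) <> [set 0],
        d.1 *: B <> d.2 *: A,
        joint_H A B @^-1` [set - d] = set0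
      | exists2 u, (joint_H A B @^-1` [set - d]) u & lindep2 d (joint_L a b u)]).
Proof.
split=> [cvx d d0 | cond].
  have [L0|] := pselect (joint_L a b @` (kernel A `&` kernel B) = [set 0]); last first.
    by move=> ?; constructor 1.
  have [dBA|] := pselect (d.1 *: B = d.2 *: A); last by move=> ?; constructor 2.
  have [->|/set0P[u Hu]] := eqVneq (joint_H A B @^-1` [set - d]) set0.
    by constructor 3.
  by constructor 4; exact: (convex_joint_lindep hA hB d0 cvx L0 dBA Hu).
apply/convex_setW => _ _ /set_mem[x _ <-] /set_mem[y _ <-] k k0 k1.
apply/mem_set; apply: contrapT => no_sol.
have [z Az Bz|w [w0 dep ker indep]] := @gap_direction _ _ A B a b x y
  (k%:num * qfun A a x + (1 - k%:num) * qfun A a y)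
  (k%:num * qfun B b x + (1 - k%:num) * qfun B b y) k%:num hA hB k0 k1 erefl erefl.
  by apply: no_sol; exists z => //; rewrite /joint Az Bz.
(* The point [w] itself lies in the fibre; the other cases contradict the conclusions of
   [gap_direction]. *)
have [|L0|dBA|H0|[u Hu]] := cond (- joint_H A B w).
- by move=> /eqP; rewrite oppr_eq0 => /eqP[Aw Bw]; apply: w0.
- apply: L0; apply/seteqP; split=> [_ [z [Az Bz] <-] | _ ->].
    by have [az bz] := ker z Az Bz; rewrite /joint_L az bz.
  exists 0; last by rewrite /joint_L !inner0r.
  by split; rewrite /kernel /= mulmx0.
- by apply: dBA; rewrite /= !scaleNr dep.
- have : set0 w by rewrite -H0 /= opprK.
  by [].
- move: Hu; rewrite /= opprK => -[Au Bu] /lindep2P /= dl.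
  by apply: (indep u Au Bu); move: dl; rewrite !mulNr => /oppr_inj.
Qed.
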